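(* Let $\mathcal K$ be an augmented virtual equipment that has cocartesian tabulations. Let $d\colon A\to M$, $j\colon A\to B$ and $l\colon B\to M$ be vertical morphisms such that the companion $j_*\colon A\nrightarrow B$ exists, let $\eta\colon d\Rightarrow l\circ j$ be a vertical cell and let $\eta'\colon j_*\Rightarrow M$ (with vertical source $d$ and vertical target $l$) be its factorisation $\eta=\eta'\circ\mathrm{cocart}$ through the weakly cocartesian cell $\mathrm{cocart}\colon(A)\Rightarrow j_*$ defining $j_*$. The vertical cell $\eta$ defines $l$ as the pointwise left Kan extension of $d$ along $j$ in the $2$-category $V(\mathcal K)$ (in the sense of Street) precisely if $\eta'$ defines $l$ as the pointwise left Kan extension of $d$ along $j_*$ in $\mathcal K$.
   Context: **Augmented virtual double category** $\mathcal K$: it consists of objects; a category of vertical morphisms $f\colon A\to C$ between these objects; horizontal morphisms $J\colon A\nrightarrow B$ between objects; and cells. A cell $\phi\colon\underline J\Rightarrow\underline K$ has a horizontal source $\underline J=(J_1,\dotsc,J_n)$, a path $J_i\colon A_{i-1}\nrightarrow A_i$ of length $n\ge0$ (the empty path at $A_0$ is written $(A_0)$); a horizontal target $\underline K$, a path from $C$ to $D$ of length at most $1$ (so $\underline K=K\colon C\nrightarrow D$, or $\underline K=(C)$ with $C=D$, also written $\phi\colon\underline J\Rightarrow C$); a vertical source $f\colon A_0\to C$ and a vertical target $g\colon A_n\to D$. It is unary if $\underline K$ has length $1$, nullary if $\underline K$ has length $0$, vertical if $\underline J$ and $\underline K$ are both empty (written $\phi\colon f\Rightarrow g$), horizontal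 if $f$ and $g$ are identities. Given $n\ge1$ cells $\phi_i\colon\underline J_i\Rightarrow\underline K_i$, the vertical target of each being the vertical source of the next, and a cell $\psi\colon\underline K_1\frown\dotsb\frown\underline K_n\Rightarrow\underline L$ ($\frown$ denotes concatenation), there is a composite $\psi\circ(\phi_1,\dotsc,\phi_n)\colon\underline J_1\frown\dotsb\frown\underline J_n\Rightarrow\underline L$ whose vertical source (target) is that of $\psi$ composed with that of $\phi_1$ ($\phi_n$). There are identity cells $\mathrm{id}_J\colon J\Rightarrow J$ (horizontal) and $\mathrm{id}_f\colon f\Rightarrow f$ (vertical), with $\mathrm{id}_h\circ(\mathrm{id}_f)=\mathrm{id}_{h\circ f}$; $\mathrm{id}_A:=\mathrm{id}_{\mathrm{id}_A}$. Axioms: $\chi\circ(\psi_1\circ(\phi_{11},\dotsc,\phi_{1m_1}),\dotsc,\psi_n\circ(\phi_{n1},\dotsc,\phi_{nm_n}))=(\chi\circ(\psi_1,\dotsc,\psi_n))\circ(\phi_{11},\dotsc,\phi_{nm_n})$ whenever the left-hand side makes sense; $\mathrm{id}_C\circ(\phi)=\phi$, $\mathrm{id}_K\circ(\phi)=\phi$, $\phi\circ(\mathrm{id}_A)=\phi$, $\phi\circ(\mathrm{id}_{J_1},\dotsc,\mathrm{id}_{J_n})=\phi$ and $\psi\circ(\phi_1,\dotsc,\phi_i,\mathrm{id}_{f_i},\phi_{i+1},\dotsc,\phi_n)=\psi\circ(\phi_1,\dotsc,\phi_n)$ whenever these make sense. Notation: $h\circ\phi:=\mathrm{id}_h\circ(\phi)$,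 $\psi\circ f:=\psi\circ(\mathrm{id}_f)$; for adjacent cells $\phi\colon\underline J\Rightarrow\underline K$, $\psi\colon\underline H\Rightarrow\underline L$ with $\underline K\frown\underline L$ of length $\le1$, $\phi\odot\psi:=\mathrm{id}_{\underline K\frown\underline L}\circ(\phi,\psi)$, where $\mathrm{id}_{(C)}$ means $\mathrm{id}_C$. $V(\mathcal K)$ is the $2$-category of objects, vertical morphisms and vertical cells of $\mathcal K$, with $\odot$ as composition of $2$-cells. **Cartesian cells, restrictions, companions.** A cell $\psi\colon\underline J\Rightarrow\underline K$ with $\underline J$ of length $\le1$, vertical source $f$ and target $g$, is cartesian if every cell $\chi\colon\underline H\Rightarrow\underline K$ with vertical source $f\circ h$ and target $g\circ k$ factors uniquely as $\chi=\psi\circ\phi$ with $\phi\colon\underline H\Rightarrow\underline J$ having vertical source $h$ and target $k$. If $\underline J=J$ has length $1$ then $J$ is the restriction $\underline K(f,g)$ of $\underline K$ along $f$ and $g$; it is called unary if $\underline K$ has length $1$. An augmented virtual equipment is an augmented virtual double category that has all unary restrictions. The companion $j_*\colon A\nrightarrow B$ of $j\colon A\to B$ is defined by a cartesian cell $\mathrm{cart}\colon j_*\Rightarrow B$ with vertical source $j$ and target $\mathrm{id}_B$; corresponding to it is a unique weakly cocartesian cell $\mathrm{cocart}\colon(A)\Rightarrow j_*$, with vertical source $\mathrm{id}_A$ and target $j$, such that $\mathrm{cart}\circ\mathrm{cocart}=\mathrm{id}_j$ and $\mathrm{cocart}\odot\mathrm{cart}=\mathrm{id}_{j_*}$. **Cocartesian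 cells.** A path $(\phi_1,\dotsc,\phi_n)$ of unary cells $\phi_i\colon\underline J_i\Rightarrow K_i$, $K_i\colon C_{i-1}\nrightarrow C_i$, with successive vertical sources/targets $f_0,\dotsc,f_n$, is weakly cocartesian if every cell $\psi$ with horizontal source $\underline J_1\frown\dotsb\frown\underline J_n$, vertical source $h\circ f_0$ and vertical target $k\circ f_n$ factors uniquely as $\psi'\circ(\phi_1,\dotsc,\phi_n)$ with $\psi'$ having horizontal source $(K_1,\dotsc,K_n)$, vertical source $h$ and target $k$. It is cocartesian if moreover (a) the restrictions $J'(\mathrm{id},f_0)$ and $J''(f_n,\mathrm{id})$ exist for all $J'\colon A'\nrightarrow C_0$ and $J''\colon C_n\nrightarrow A''$, and (b) for all paths $(J'_1,\dotsc,J'_p)$ ending at $C_0$ and $(J''_1,\dotsc,J''_q)$ starting at $C_n$, $p,q\ge0$, the path $(\mathrm{id}_{J'_1},\dotsc,\mathrm{id}_{J'_{p-1}},\mathrm{cart},\phi_1,\dotsc,\phi_n,\mathrm{cart},\mathrm{id}_{J''_2},\dotsc,\mathrm{id}_{J''_q})$ is weakly cocartesian, with $\mathrm{cart}\colon J'_p(\mathrm{id},f_0)\Rightarrow J'_p$ and $\mathrm{cart}\colon J''_1(f_n,\mathrm{id})\Rightarrow J''_1$ the cartesian cells (the left, resp. right, part being omitted if $p=0$, resp. $q=0$). A single cell is (weakly) cocartesian if it is so as a path of length $1$. **Tabulations.** A tabulation of $J\colon A\nrightarrow B$ is an object $\langle J\rangle$ with a unary cell $\pi\colon(\langle J\rangle)\Rightarrow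 J$, with vertical source $\pi_A\colon\langle J\rangle\to A$ and target $\pi_B\colon\langle J\rangle\to B$, such that: (1) every unary cell $\phi\colon(X)\Rightarrow J$, with vertical source $\phi_A$ and target $\phi_B$, equals $\pi\circ\phi'$ for a unique vertical morphism $\phi'\colon X\to\langle J\rangle$; (2) given unary cells $\phi\colon(X)\Rightarrow J$ and $\psi\colon(Y)\Rightarrow J$, with corresponding $\phi'$ and $\psi'$, a path $\underline H$ from $X$ to $Y$ and nullary cells $\xi_A\colon\underline H\Rightarrow A$ (vertical source $\phi_A$, target $\psi_A$) and $\xi_B\colon\underline H\Rightarrow B$ (vertical source $\phi_B$, target $\psi_B$) with $\xi_A\odot\psi=\phi\odot\xi_B$, there is a unique nullary cell $\xi'\colon\underline H\Rightarrow\langle J\rangle$, with vertical source $\phi'$ and target $\psi'$, such that $\pi_A\circ\xi'=\xi_A$ and $\pi_B\circ\xi'=\xi_B$. ''Has cocartesian tabulations'' means that every horizontal morphism admits a tabulation with $\pi$ cocartesian. **Kan extensions in $\mathcal K$.** Let $\eta\colon(J_1,\dotsc,J_n)\Rightarrow M$ be a nullary cell with vertical source $d\colon A_0\to M$ and target $l\colon A_n\to M$. It defines $l$ as the left Kan extension of $d$ along $(J_1,\dotsc,J_n)$ if for every path $\underline H=(H_1,\dotsc,H_m)$, $m\ge0$, from $A_n$ to $B_m$ and every $k\colon B_m\to M$, each nullary cell $\phi\colon(J_1,\dotsc,J_n)\frown\underline H\Rightarrow M$ with vertical source $d$ and target $k$ factors uniquely as $\phi=\eta\odot\phi'$ with $\phi'\colon\underline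 H\Rightarrow M$ having vertical source $l$ and target $k$. If $n\ge1$, it defines $l$ as the pointwise left Kan extension if, for every $f\colon B\to A_n$ such that $J_n(\mathrm{id},f)$ exists, $\eta\circ(\mathrm{id}_{J_1},\dotsc,\mathrm{id}_{J_{n-1}},\mathrm{cart})$, with $\mathrm{cart}\colon J_n(\mathrm{id},f)\Rightarrow J_n$, defines $l\circ f$ as the left Kan extension of $d$ along $(J_1,\dotsc,J_{n-1},J_n(\mathrm{id},f))$. **Pointwise Kan extensions in a $2$-category (Street).** $\eta\colon d\Rightarrow l\circ j$ defines $l$ as the pointwise left Kan extension of $d$ along $j\colon A\to B$ if for every $f\colon C\to B$, with comma object $j/f$ having projections $p\colon j/f\to A$, $q\colon j/f\to C$ and universal $2$-cell $\lambda\colon j\circ p\Rightarrow f\circ q$, the composite $2$-cell $d\circ p\Rightarrow l\circ j\circ p\Rightarrow l\circ f\circ q$ of $\eta\circ p$ and $l\circ\lambda$ defines $l\circ f$ as the (ordinary) left Kan extension of $d\circ p$ along $q$. *)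

(* Defs.v *)
From Stdlib Require Import ssreflect ProofIrrelevance.

Set Implicit Arguments.
Unset Strict Implicit.
Unset Printing Implicit Defensive.

(* Conventions.
   - Paths, cells and vertical morphisms are indexed by their boundary.
     Boundaries of composites often agree only propositionally (associativity
     and unitality of vertical composition and of concatenation), so [scons],
     [sapp], [comp] and [hcomp] take as last arguments equations that name the
     boundary of their result; with [eq_refl] they are the plain operations,
     and all equations between cells are homogeneous.
   - Vertical composition [vcomp g f] is g after f. *)

(** * Paths of horizontal morphisms *)

Section Paths.
Variables (ob : Type) (hor : ob -> ob -> Type).

Inductive path : ob -> ob -> Type :=
| pnil (A : ob) : path A A
| pcons (A B C : ob) (J : hor A B) (P : path B C) : path A C.

Definition pone (A B : ob) (J : hor A B) : path A B := pcons J (pnil B).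

Fixpoint papp (A B : ob) (P : path A B) (C : ob) : path B C -> path A C :=
  match P in path A B return path B C -> path A C with
  | pnil _ => fun Q => Q
  | pcons J P' => fun Q => pcons J (papp P' Q)
  end.

Lemma papp_nil (A B : ob) (P : path A B) : papp P (pnil B) = P.
Proof. by elim: P => //= A' B' C' J P ->. Qed.

Lemma papp_assoc (A B C D : ob) (P : path A B) (Q : path B C) (R : path C D) :
  papp P (papp Q R) = papp (papp P Q) R.
Proof. by elim: P Q => //= A' B' C' J P IH Q; rewrite IH. Qed.

Lemma papp_assoc_eq (A B C D : ob) (P : path A B) (Q : path B C)
    (PQ : path A C) (R : path C D) (S : path A D) :
  papp P Q = PQ -> papp PQ R = S -> papp P (papp Q R) = S.
Proof. by move=> <- <-; exact: papp_assoc. Qed.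

(* Paths of length at most 1. *)
Inductive tpath : ob -> ob -> Type :=
| tnil (C : ob) : tpath C C
| tone (C D : ob) (K : hor C D) : tpath C D.

Definition tp (C D : ob) (K : tpath C D) : path C D :=
  match K with
  | tnil C => pnil C
  | tone K => pone K
  end.

End Paths.

Arguments pnil {ob hor} A.
Arguments tnil {ob hor} C.

(** * Paths of cells *)

Section Strips.
Variables (ob : Type) (ver hor : ob -> ob -> Type).
Variable cell : forall (A B C D : ob),
  path hor A B -> tpath hor C D -> ver A C -> ver B D -> Type.

(* A nonempty list (phi_1, ..., phi_n) of cells phi_i : J_i => K_i, the
   vertical target of each being the vertical source of the next, indexed by
   J_1 ++ ... ++ J_n, by K_1 ++ ... ++ K_n and by the outer vertical source
   and target. *)
Inductive strip : forall (A B C D : ob),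
  path hor A B -> path hor C D -> ver A C -> ver B D -> Type :=
| sone (A B C D : ob) (J : path hor A B) (K : tpath hor C D)
    (f : ver A C) (g : ver B D) (phi : cell J K f g) : strip J (tp K) f g
| scons (A B B' C D D' : ob) (J : path hor A B) (K : tpath hor C D)
    (f : ver A C) (g : ver B D) (phi : cell J K f g)
    (J' : path hor B B') (K' : path hor D D') (h : ver B' D')
    (s : strip J' K' g h)
    (J'' : path hor A B') (K'' : path hor C D')
    (eJ : papp J J' = J'') (eK : papp (tp K) K' = K'') : strip J'' K'' f h.

Fixpoint sapp (A B C D : ob) (J : path hor A B) (K : path hor C D)
    (f : ver A C) (g : ver B D) (s : strip J K f g) :
  forall (B' D' : ob) (J' : path hor B B') (K' : path hor D D')
    (h : ver B' D') (s' : strip J' K' g h)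
    (J'' : path hor A B') (K'' : path hor C D'),
  papp J J' = J'' -> papp K K' = K'' -> strip J'' K'' f h :=
  match s in @strip A B C D J K f g return
    forall (B' D' : ob) (J' : path hor B B') (K' : path hor D D')
      (h : ver B' D') (s' : strip J' K' g h)
      (J'' : path hor A B') (K'' : path hor C D'),
    papp J J' = J'' -> papp K K' = K'' -> strip J'' K'' f h
  with
  | sone phi => fun _ _ _ _ _ s' _ _ eJ eK => scons phi s' eJ eK
  | scons phi r eJ eK => fun _ _ _ _ _ s' _ _ eJ' eK' =>
      scons phi (sapp r s' eq_refl eq_refl)
        (papp_assoc_eq eJ eJ') (papp_assoc_eq eK eK')
  end.

Fixpoint all_unary (A B C D : ob) (J : path hor A B) (K : path hor C D)
    (f : ver A C) (g : ver B D) (s : strip J K f g) : Prop :=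
  let unary C D (K : tpath hor C D) :=
    match K with tnil _ => False | tone _ => True end in
  match s with
  | @sone _ _ _ _ _ K _ _ _ => unary _ _ K
  | @scons _ _ _ _ _ _ _ K _ _ _ _ _ _ r _ _ _ _ =>
      unary _ _ K /\ all_unary r
  end.

End Strips.

(** * Augmented virtual double categories *)

Record avdc_data := {
  ob : Type;
  ver : ob -> ob -> Type;
  vid : forall A : ob, ver A A;
  vcomp : forall A B C : ob, ver B C -> ver A B -> ver A C;
  hor : ob -> ob -> Type;
  cell : forall A B C D : ob,
    path hor A B -> tpath hor C D -> ver A C -> ver B D -> Type;
  idv : forall (A C : ob) (f : ver A C), cell (pnil A) (tnil C) f f;
  idh : forall (A B : ob) (J : hor A B),
    cell (pone J) (tone J) (vid A) (vid B);
  comp : forall (A B C D E F : ob) (J : path hor A B) (K : path hor C D)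
    (L : tpath hor E F) (f : ver A C) (g : ver B D) (h : ver C E) (k : ver D F)
    (phis : strip cell J K f g) (psi : cell K L h k)
    (p : ver A E) (q : ver B F),
    vcomp h f = p -> vcomp k g = q -> cell J L p q
}.

Arguments vid {a} A.

Notation strip_in K := (strip (@cell K)).

Section Data.
Variable K : avdc_data.

(* [tid (tnil C)] is id_C := id_{id_C}. *)
Definition tid (C D : ob K) (N : tpath (@hor K) C D) :
    cell (tp N) N (vid C) (vid D) :=
  match N with
  | tnil C => idv (vid C)
  | tone N => idh N
  end.

(* The path (phi, id_{J_1}, ..., id_{J_n}). *)
Fixpoint cell_ids (B E : ob K) (P : path (@hor K) B E) :
  forall (A C : ob K) (J : hor A B) (N : hor C B) (f : ver A C)
    (phi : cell (pone J) (tone N) f (vid B)),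
  strip_in K (pcons J P) (pcons N P) f (vid E) :=
  match P in path _ B E return
    forall (A C : ob K) (J : hor A B) (N : hor C B) (f : ver A C)
      (phi : cell (pone J) (tone N) f (vid B)),
    strip_in K (pcons J P) (pcons N P) f (vid E)
  with
  | pnil _ => fun _ _ _ _ _ phi => sone phi
  | pcons J1 P' => fun _ _ _ _ _ phi =>
      @scons _ _ _ (@cell K) _ _ _ _ _ _ _ _ _ _ phi
        _ _ _ (cell_ids P' (idh J1)) _ _ eq_refl eq_refl
  end.

(* The path (id_{J_1}, ..., id_{J_n}, phi_1, ..., phi_m), n >= 0. *)
Fixpoint ids_strip (A B : ob K) (P : path (@hor K) A B) :
  forall (B' D' : ob K) (J : path (@hor K) B B') (N : path (@hor K) B D')
    (g : ver B' D') (s : strip_in K J N (vid B) g),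
  strip_in K (papp P J) (papp P N) (vid A) g :=
  match P in path _ A B return
    forall (B' D' : ob K) (J : path (@hor K) B B') (N : path (@hor K) B D')
      (g : ver B' D') (s : strip_in K J N (vid B) g),
    strip_in K (papp P J) (papp P N) (vid A) g
  with
  | pnil _ => fun _ _ _ _ _ s => s
  | pcons J1 P' => fun _ _ _ _ _ s =>
      @scons _ _ _ (@cell K) _ _ _ _ _ _ _ _ _ _ (idh J1)
        _ _ _ (ids_strip P' s) _ _ eq_refl eq_refl
  end.

(* A nonempty list of composable pairs (phi_{i1}, ..., phi_{i m_i}), psi_i,
   for the associativity axiom: [lower] is the list of all phi_{ij}, [middle]
   the list of the psi_i, and [outer] that of the composites. *)
Inductive strip2 : forall (A B C D E F : ob K), path (@hor K) A B ->
  path (@hor K) C D -> path (@hor K) E F ->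
  ver A C -> ver B D -> ver C E -> ver D F -> Type :=
| one2 (A B C D E F : ob K) (J : path (@hor K) A B) (N : path (@hor K) C D)
    (L : tpath (@hor K) E F)
    (f : ver A C) (g : ver B D) (h : ver C E) (k : ver D F)
    (phis : strip_in K J N f g) (psi : cell N L h k) :
    strip2 J N (tp L) f g h k
| cons2 (A B C D E F B' D' F' : ob K)
    (J : path (@hor K) A B) (N : path (@hor K) C D) (L : tpath (@hor K) E F)
    (f : ver A C) (g : ver B D) (h : ver C E) (k : ver D F)
    (phis : strip_in K J N f g) (psi : cell N L h k)
    (J' : path (@hor K) B B') (N' : path (@hor K) D D')
    (L' : path (@hor K) F F') (g' : ver B' D') (k' : ver D' F')
    (r : strip2 J' N' L' g g' k k')
    (J'' : path (@hor K) A B') (N'' : path (@hor K) C D')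
    (L'' : path (@hor K) E F')
    (eJ : papp J J' = J'') (eN : papp N N' = N'')
    (eL : papp (tp L) L' = L'') : strip2 J'' N'' L'' f g' h k'.

Fixpoint lower (A B C D E F : ob K) (J : path (@hor K) A B)
    (N : path (@hor K) C D) (L : path (@hor K) E F)
    (f : ver A C) (g : ver B D) (h : ver C E) (k : ver D F)
    (s : strip2 J N L f g h k) : strip_in K J N f g :=
  match s in @strip2 _ _ _ _ _ _ J N _ f g _ _ return strip_in K J N f g with
  | one2 phis _ => phis
  | cons2 phis _ r eJ eN _ => sapp phis (lower r) eJ eN
  end.

Fixpoint middle (A B C D E F : ob K) (J : path (@hor K) A B)
    (N : path (@hor K) C D) (L : path (@hor K) E F)
    (f : ver A C) (g : ver B D) (h : ver C E) (k : ver D F)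
    (s : strip2 J N L f g h k) : strip_in K N L h k :=
  match s in @strip2 _ _ _ _ _ _ _ N L _ _ h k return strip_in K N L h k with
  | one2 _ psi => sone psi
  | cons2 _ psi r _ eN eL => scons psi (middle r) eN eL
  end.

Fixpoint outer (A B C D E F : ob K) (J : path (@hor K) A B)
    (N : path (@hor K) C D) (L : path (@hor K) E F)
    (f : ver A C) (g : ver B D) (h : ver C E) (k : ver D F)
    (s : strip2 J N L f g h k) : strip_in K J L (vcomp h f) (vcomp k g) :=
  match s in @strip2 _ _ _ _ _ _ J _ L f g h k
    return strip_in K J L (vcomp h f) (vcomp k g) with
  | one2 phis psi => sone (comp phis psi eq_refl eq_refl)
  | cons2 phis psi r eJ _ eL =>
      scons (comp phis psi eq_refl eq_refl) (outer r) eJ eL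
  end.

End Data.

Record avdc := {
  avdc_sort :> avdc_data;
  vcomp_idl : forall (A B : ob avdc_sort) (f : ver A B),
    vcomp (vid B) f = f;
  vcomp_idr : forall (A B : ob avdc_sort) (f : ver A B),
    vcomp f (vid A) = f;
  vcomp_assoc : forall (A B C D : ob avdc_sort)
    (h : ver C D) (g : ver B C) (f : ver A B),
    vcomp h (vcomp g f) = vcomp (vcomp h g) f;
  idv_comp : forall (A B C : ob avdc_sort) (h : ver B C) (f : ver A B),
    comp (sone (idv f)) (idv h) eq_refl eq_refl = idv (vcomp h f);
  comp_assoc : forall (A B C D E F G H : ob avdc_sort)
    (J : path (@hor avdc_sort) A B) (N : path (@hor avdc_sort) C D)
    (L : path (@hor avdc_sort) E F) (R : tpath (@hor avdc_sort) G H)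
    (f : ver A C) (g : ver B D) (h : ver C E) (k : ver D F)
    (u : ver E G) (v : ver F H)
    (s : strip2 J N L f g h k) (chi : cell L R u v)
    (p : ver A G) (q : ver B H)
    (el : vcomp u (vcomp h f) = p) (er : vcomp v (vcomp k g) = q)
    (el' : vcomp (vcomp u h) f = p) (er' : vcomp (vcomp v k) g = q),
    comp (outer s) chi el er =
    comp (lower s) (comp (middle s) chi eq_refl eq_refl) el' er';
  (* id_C o (phi) = phi and id_K o (phi) = phi *)
  comp_idl : forall (A B C D : ob avdc_sort) (J : path (@hor avdc_sort) A B)
    (N : tpath (@hor avdc_sort) C D) (f : ver A C) (g : ver B D)
    (phi : cell J N f g) (ef : vcomp (vid C) f = f) (eg : vcomp (vid D) g = g),
    comp (sone phi) (tid N) ef eg = phi;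
  comp_idr_nil : forall (A C D : ob avdc_sort)
    (N : tpath (@hor avdc_sort) C D) (f : ver A C) (g : ver A D)
    (phi : cell (pnil A) N f g)
    (ef : vcomp f (vid A) = f) (eg : vcomp g (vid A) = g),
    comp (sone (idv (vid A))) phi ef eg = phi;
  comp_idr_cons : forall (A A' B C D : ob avdc_sort)
    (J : hor A A') (P : path (@hor avdc_sort) A' B)
    (N : tpath (@hor avdc_sort) C D) (f : ver A C) (g : ver B D)
    (phi : cell (pcons J P) N f g)
    (ef : vcomp f (vid A) = f) (eg : vcomp g (vid B) = g),
    comp (cell_ids P (idh J)) phi ef eg = phi;
  (* psi o (phi_1, ..., id_{f_i}, ..., phi_n) = psi o (phi_1, ..., phi_n):
     i = 0, i = n and 0 < i < n. *)
  comp_insert_first : forall (A B C D E F : ob avdc_sort)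
    (J : path (@hor avdc_sort) A B) (N : path (@hor avdc_sort) C D)
    (L : tpath (@hor avdc_sort) E F)
    (f : ver A C) (g : ver B D) (h : ver C E) (k : ver D F)
    (s : strip_in avdc_sort J N f g) (psi : cell N L h k)
    (p : ver A E) (q : ver B F) (el : vcomp h f = p) (er : vcomp k g = q),
    comp (scons (idv f) s eq_refl eq_refl) psi el er = comp s psi el er;
  comp_insert_last : forall (A B C D E F : ob avdc_sort)
    (J : path (@hor avdc_sort) A B) (N : path (@hor avdc_sort) C D)
    (L : tpath (@hor avdc_sort) E F)
    (f : ver A C) (g : ver B D) (h : ver C E) (k : ver D F)
    (s : strip_in avdc_sort J N f g) (psi : cell N L h k)
    (p : ver A E) (q : ver B F) (el : vcomp h f = p) (er : vcomp k g = q),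
    comp (sapp s (sone (idv g)) (papp_nil J) (papp_nil N)) psi el er =
    comp s psi el er;
  comp_insert_middle : forall (A B C D B' D' E F : ob avdc_sort)
    (J : path (@hor avdc_sort) A B) (N : path (@hor avdc_sort) C D)
    (J' : path (@hor avdc_sort) B B') (N' : path (@hor avdc_sort) D D')
    (L : tpath (@hor avdc_sort) E F)
    (f : ver A C) (g : ver B D) (g' : ver B' D') (h : ver C E) (k : ver D' F)
    (s : strip_in avdc_sort J N f g) (s' : strip_in avdc_sort J' N' g g')
    (psi : cell (papp N N') L h k)
    (p : ver A E) (q : ver B' F) (el : vcomp h f = p) (er : vcomp k g' = q),
    comp (sapp s (scons (idv g) s' eq_refl eq_refl) eq_refl eq_refl) psi el er =
    comp (sapp s s' eq_refl eq_refl) psi el er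
}.

(** * 2-categories *)

Definition cast2 (T : Type) (R : T -> T -> Type) (f f' g g' : T)
    (e : f = f') (e' : g = g') (a : R f g) : R f' g' :=
  match e in _ = f1, e' in _ = g1 return R f1 g1 with
  | eq_refl, eq_refl => a
  end.

Record twocat := {
  tob : Type;
  hom : tob -> tob -> Type;
  id1 : forall A : tob, hom A A;
  c1 : forall A B C : tob, hom B C -> hom A B -> hom A C;
  hom2 : forall A B : tob, hom A B -> hom A B -> Type;
  id2 : forall (A B : tob) (f : hom A B), hom2 f f;
  c2 : forall (A B : tob) (f g h : hom A B),
    hom2 f g -> hom2 g h -> hom2 f h; (* diagrammatic order *)
  wl : forall (A B C : tob) (h : hom B C) (f g : hom A B),
    hom2 f g -> hom2 (c1 h f) (c1 h g);
  wr : forall (A B C : tob) (g h : hom B C) (a : hom2 g h) (f : hom A B),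
    hom2 (c1 g f) (c1 h f);
  c1_idl : forall (A B : tob) (f : hom A B), c1 (id1 B) f = f;
  c1_idr : forall (A B : tob) (f : hom A B), c1 f (id1 A) = f;
  c1_assoc : forall (A B C D : tob) (h : hom C D) (g : hom B C) (f : hom A B),
    c1 h (c1 g f) = c1 (c1 h g) f;
  c2_idl : forall (A B : tob) (f g : hom A B) (a : hom2 f g),
    c2 (id2 f) a = a;
  c2_idr : forall (A B : tob) (f g : hom A B) (a : hom2 f g),
    c2 a (id2 g) = a;
  c2_assoc : forall (A B : tob) (f g h k : hom A B)
    (a : hom2 f g) (b : hom2 g h) (c : hom2 h k),
    c2 a (c2 b c) = c2 (c2 a b) c;
  wl_id2 : forall (A B C : tob) (h : hom B C) (f : hom A B),
    wl h (id2 f) = id2 (c1 h f);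
  wl_c2 : forall (A B C : tob) (k : hom B C) (f g h : hom A B)
    (a : hom2 f g) (b : hom2 g h), wl k (c2 a b) = c2 (wl k a) (wl k b);
  wr_id2 : forall (A B C : tob) (h : hom B C) (f : hom A B),
    wr (id2 h) f = id2 (c1 h f);
  wr_c2 : forall (A B C : tob) (f g h : hom B C)
    (a : hom2 f g) (b : hom2 g h) (k : hom A B),
    wr (c2 a b) k = c2 (wr a k) (wr b k);
  wl_id1 : forall (A B : tob) (f g : hom A B) (a : hom2 f g),
    cast2 (c1_idl f) (c1_idl g) (wl (id1 B) a) = a;
  wr_id1 : forall (A B : tob) (f g : hom A B) (a : hom2 f g),
    cast2 (c1_idr f) (c1_idr g) (wr a (id1 A)) = a;
  wl_c1 : forall (A B C D : tob) (k : hom C D) (h : hom B C)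
    (f g : hom A B) (a : hom2 f g),
    cast2 (c1_assoc k h f) (c1_assoc k h g) (wl k (wl h a)) = wl (c1 k h) a;
  wr_c1 : forall (A B C D : tob) (f g : hom C D) (a : hom2 f g)
    (h : hom B C) (k : hom A B),
    cast2 (c1_assoc f h k) (c1_assoc g h k) (wr a (c1 h k)) = wr (wr a h) k;
  wl_wr : forall (A B C D : tob) (h : hom C D) (f g : hom B C)
    (a : hom2 f g) (k : hom A B),
    cast2 (c1_assoc h f k) (c1_assoc h g k) (wl h (wr a k)) = wr (wl h a) k;
  interchange : forall (A B C : tob) (f f' : hom A B) (g g' : hom B C)
    (a : hom2 f f') (b : hom2 g g'),
    c2 (wl g a) (wr b f') = c2 (wr b f) (wl g' a)
}.

Arguments id1 {t} A.

Section TwoCat.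
Variable C : twocat.

Definition is_lan2 (A B M : tob C) (d : hom A M) (j : hom A B) (l : hom B M)
    (eta : hom2 d (c1 l j)) : Prop :=
  forall (k : hom B M) (phi : hom2 d (c1 k j)),
    exists! phi' : hom2 l k, phi = c2 eta (wr phi' j).

Lemma c1_assoc_eq (X P A B : tob C) (j : hom A B) (p : hom P A) (u : hom X P)
    (a : hom X A) : c1 p u = a -> c1 (c1 j p) u = c1 j a.
Proof. by move=> <-; rewrite c1_assoc. Qed.

Definition is_comma (A B D : tob C) (j : hom A B) (f : hom D B)
    (P : tob C) (p : hom P A) (q : hom P D) (lam : hom2 (c1 j p) (c1 f q)) :
    Prop :=
  (forall (X : tob C) (a : hom X A) (b : hom X D) (mu : hom2 (c1 j a) (c1 f b)),
     exists! u : hom X P,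
       exists (ea : c1 p u = a) (eb : c1 q u = b),
         cast2 (c1_assoc_eq j ea) (c1_assoc_eq f eb) (wr lam u) = mu) /\
  (forall (X : tob C) (u v : hom X P)
     (a : hom2 (c1 p u) (c1 p v)) (b : hom2 (c1 q u) (c1 q v)),
     c2 (wr lam u) (cast2 (c1_assoc f q u) (c1_assoc f q v) (wl f b)) =
     c2 (cast2 (c1_assoc j p u) (c1_assoc j p v) (wl j a)) (wr lam v) ->
     exists! c : hom2 u v, wl p c = a /\ wl q c = b).

(* d p => l j p => l f q *)
Definition comma_pasting (A B M D P : tob C) (d : hom A M) (j : hom A B)
    (l : hom B M) (eta : hom2 d (c1 l j)) (f : hom D B)
    (p : hom P A) (q : hom P D) (lam : hom2 (c1 j p) (c1 f q)) :
    hom2 (c1 d p) (c1 (c1 l f) q) :=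
  c2 (wr eta p) (cast2 (c1_assoc l j p) (c1_assoc l f q) (wl l lam)).

(* "The" comma object: one exists, and the condition holds for any of them. *)
Definition is_pointwise_lan2 (A B M : tob C) (d : hom A M) (j : hom A B)
    (l : hom B M) (eta : hom2 d (c1 l j)) : Prop :=
  forall (D : tob C) (f : hom D B),
    (exists (P : tob C) (p : hom P A) (q : hom P D)
       (lam : hom2 (c1 j p) (c1 f q)), is_comma lam) /\
    (forall (P : tob C) (p : hom P A) (q : hom P D)
       (lam : hom2 (c1 j p) (c1 f q)),
       is_comma lam -> is_lan2 (comma_pasting eta lam)).

End TwoCat.

(** * The theory of augmented virtual double categories *)

Section Theory.
Variable K : avdc.

Notation hpath := (path (@hor K)).
Notation htpath := (tpath (@hor K)).

Definition hcomp (A B B' C D D' : ob K) (J : hpath A B) (N : htpath C D)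
    (f : ver A C) (g : ver B D) (phi : cell J N f g)
    (H : hpath B B') (L : htpath D D') (h : ver B' D') (psi : cell H L g h)
    (P : hpath A B') (R : htpath C D')
    (eP : papp J H = P) (eR : papp (tp N) (tp L) = tp R) : cell P R f h :=
  comp (scons phi (sone psi) eP eR) (tid R) (vcomp_idl f) (vcomp_idl h).

Definition vcell (A C : ob K) (f g : ver A C) : Type :=
  cell (pnil A) (tnil C) f g.

Definition vcell_comp (A C : ob K) (f g h : ver A C)
    (a : vcell f g) (b : vcell g h) : vcell f h :=
  hcomp a b (P := pnil A) (R := tnil C) eq_refl eq_refl.

(* h o phi *)
Definition post (A B C D : ob K) (J : hpath A B) (f : ver A C) (g : ver B C)
    (h : ver C D) (phi : cell J (tnil C) f g)
    (p : ver A D) (q : ver B D) (el : vcomp h f = p) (er : vcomp h g = q) :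
    cell J (tnil D) p q :=
  comp (sone phi) (idv h) el er.

(* psi o f *)
Definition pre (A B C D : ob K) (N : htpath C D) (h : ver B C) (k : ver B D)
    (psi : cell (pnil B) N h k) (f : ver A B)
    (p : ver A C) (q : ver A D) (el : vcomp h f = p) (er : vcomp k f = q) :
    cell (pnil A) N p q :=
  comp (sone (idv f)) psi el er.

(** ** Cartesian and cocartesian cells *)

Definition cartesian (A B C D : ob K) (J : htpath A B) (N : htpath C D)
    (f : ver A C) (g : ver B D) (psi : cell (tp J) N f g) : Prop :=
  forall (A' B' : ob K) (H : hpath A' B') (h : ver A' A) (k : ver B' B)
    (chi : cell H N (vcomp f h) (vcomp g k)),
  exists! phi : cell H J h k, chi = comp (sone phi) psi eq_refl eq_refl.

(* [psi] exhibits the horizontal morphism [J] as the restriction N(f, g). *)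
Definition is_restriction (A B C D : ob K) (J : hor A B) (N : htpath C D)
    (f : ver A C) (g : ver B D) (psi : cell (pone J) N f g) : Prop :=
  @cartesian A B C D (tone J) N f g psi.

Definition has_restriction (A B C D : ob K) (N : htpath C D)
    (f : ver A C) (g : ver B D) : Prop :=
  exists (J : hor A B) (psi : cell (pone J) N f g), is_restriction psi.

Definition augmented_virtual_equipment : Prop :=
  forall (A B C D : ob K) (N : hor C D) (f : ver A C) (g : ver B D),
    has_restriction (tone N) f g.

Definition weakly_cocartesian (A B C D : ob K) (J : hpath A B) (N : hpath C D)
    (f : ver A C) (g : ver B D) (phis : strip_in K J N f g) : Prop :=
  all_unary phis /\
  forall (E F : ob K) (L : htpath E F) (h : ver C E) (k : ver D F)
    (psi : cell J L (vcomp h f) (vcomp k g)),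
  exists! psi' : cell N L h k, psi = comp phis psi' eq_refl eq_refl.

(* [right_ext s t]: t is s, or t is (s, cart, id_{J''_2}, ..., id_{J''_q}) with
   cart : J''_1(g, id) => J''_1. *)
Inductive right_ext (A B C D : ob K) (J : hpath A B) (N : hpath C D)
    (f : ver A C) (g : ver B D) (s : strip_in K J N f g) :
  forall (B' D' : ob K) (J' : hpath A B') (N' : hpath C D') (g' : ver B' D'),
    strip_in K J' N' f g' -> Prop :=
| right_ext0 : right_ext s s
| right_ext_cart (D' D'' : ob K) (J1 : hor D D') (R : hor B D')
    (cart : cell (pone R) (tone J1) g (vid D')) (P : hpath D' D'') :
    is_restriction cart ->
    right_ext s (sapp s (cell_ids P cart) eq_refl eq_refl).

(* [left_ext s t]: t is s, or t is (id_{J'_1}, ..., id_{J'_{p-1}}, cart, s)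
   with cart : J'_p(id, f) => J'_p. *)
Inductive left_ext (A B C D : ob K) (J : hpath A B) (N : hpath C D)
    (f : ver A C) (g : ver B D) (s : strip_in K J N f g) :
  forall (A' C' : ob K) (J' : hpath A' B) (N' : hpath C' D) (f' : ver A' C'),
    strip_in K J' N' f' g -> Prop :=
| left_ext0 : left_ext s s
| left_ext_cart (C' C'' : ob K) (Jp : hor C' C) (R : hor C' A)
    (cart : cell (pone R) (tone Jp) (vid C') f) (P : hpath C'' C') :
    is_restriction cart ->
    left_ext s (ids_strip P (scons cart s eq_refl eq_refl)).

Definition cocartesian (A B C D : ob K) (J : hpath A B) (N : hpath C D)
    (f : ver A C) (g : ver B D) (phis : strip_in K J N f g) : Prop :=
  weakly_cocartesian phis /\
  (forall (A' : ob K) (J' : hor A' C), has_restriction (tone J') (vid A') f) /\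
  (forall (A'' : ob K) (J'' : hor D A''),
     has_restriction (tone J'') g (vid A'')) /\
  (forall (B' D' : ob K) (Jr : hpath A B') (Nr : hpath C D') (g' : ver B' D')
     (s : strip_in K Jr Nr f g'), right_ext phis s ->
   forall (A' C' : ob K) (Jl : hpath A' B') (Nl : hpath C' D') (f' : ver A' C')
     (t : strip_in K Jl Nl f' g'), left_ext s t ->
   weakly_cocartesian t).

(** ** Companions *)

Record is_companion (A B : ob K) (j : ver A B) (jstar : hor A B)
    (cart : cell (pone jstar) (tnil B) j (vid B))
    (cocart : cell (pnil A) (tone jstar) (vid A) j) : Prop := {
  companion_cart : is_restriction cart;
  companion_cocart : weakly_cocartesian (sone cocart);
  companion_vertical :
    comp (sone cocart) cart (vcomp_idr j) (vcomp_idl j) = idv j;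
  companion_horizontal :
    hcomp cocart cart (P := pone jstar) (R := tone jstar) eq_refl eq_refl =
    idh jstar
}.

(** ** Tabulations *)

Definition is_tabulation (A B : ob K) (J : hor A B) (T : ob K)
    (piA : ver T A) (piB : ver T B) (pi : cell (pnil T) (tone J) piA piB) :
    Prop :=
  (forall (X : ob K) (phiA : ver X A) (phiB : ver X B)
     (phi : cell (pnil X) (tone J) phiA phiB),
   exists! phi' : ver X T,
     exists (eA : vcomp piA phi' = phiA) (eB : vcomp piB phi' = phiB),
       phi = pre pi eA eB) /\
  (forall (X Y : ob K)
     (phiA : ver X A) (phiB : ver X B)
     (phi : cell (pnil X) (tone J) phiA phiB)
     (psiA : ver Y A) (psiB : ver Y B)
     (psi : cell (pnil Y) (tone J) psiA psiB)
     (phi' : ver X T)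
     (ephiA : vcomp piA phi' = phiA) (ephiB : vcomp piB phi' = phiB)
     (psi' : ver Y T)
     (epsiA : vcomp piA psi' = psiA) (epsiB : vcomp piB psi' = psiB)
     (H : hpath X Y)
     (xiA : cell H (tnil A) phiA psiA) (xiB : cell H (tnil B) phiB psiB),
   phi = pre pi ephiA ephiB ->
   psi = pre pi epsiA epsiB ->
   hcomp xiA psi (P := H) (R := tone J) (papp_nil H) eq_refl =
   hcomp phi xiB (P := H) (R := tone J) eq_refl eq_refl ->
   exists! xi' : cell H (tnil T) phi' psi',
     post xi' ephiA epsiA = xiA /\ post xi' ephiB epsiB = xiB).

Definition has_cocartesian_tabulations : Prop :=
  forall (A B : ob K) (J : hor A B),
  exists (T : ob K) (piA : ver T A) (piB : ver T B)
    (pi : cell (pnil T) (tone J) piA piB),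
    is_tabulation pi /\ cocartesian (sone pi).

(** ** Kan extensions *)

Definition is_lan (A B M : ob K) (J : hpath A B) (d : ver A M) (l : ver B M)
    (eta : cell J (tnil M) d l) : Prop :=
  forall (B' : ob K) (H : hpath B B') (k : ver B' M)
    (phi : cell (papp J H) (tnil M) d k),
  exists! phi' : cell H (tnil M) l k,
    phi = hcomp eta phi' (R := tnil M) eq_refl eq_refl.

(* The path (J_1, ..., J_n), n >= 1, is given as its initial part J and its
   last morphism Jn. *)
Definition is_pointwise_lan (A A' B M : ob K) (J : hpath A A') (Jn : hor A' B)
    (d : ver A M) (l : ver B M) (eta : cell (papp J (pone Jn)) (tnil M) d l) :
    Prop :=
  forall (X : ob K) (f : ver X B) (R : hor A' X)
    (cart : cell (pone R) (tone Jn) (vid A') f),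
  is_restriction cart ->
  is_lan (comp (ids_strip J (sone cart)) eta (vcomp_idr d)
            (eq_refl : vcomp l f = vcomp l f)).

End Theory.

(** * The vertical 2-category V(K) *)

Section Vertical.
Variable K : avdc.

Lemma comp_irr (A B C D E F : ob K) (J : path (@hor K) A B)
    (N : path (@hor K) C D) (L : tpath (@hor K) E F)
    (f : ver A C) (g : ver B D) (h : ver C E) (k : ver D F)
    (s s' : strip_in K J N f g) (psi psi' : cell N L h k) p q
    (ep : vcomp h f = p) (eq0 : vcomp k g = q) ep' eq0' :
  s = s' -> psi = psi' -> comp s psi ep eq0 = comp s' psi' ep' eq0'.
Proof.
move=> -> ->.
by rewrite (proof_irrelevance _ ep ep') (proof_irrelevance _ eq0 eq0').
Qed.

Lemma scons_irr (A C : ob K) (f g h : ver A C) (a : vcell f g)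
    (b : vcell g h) eJ eK :
  scons a (sone b) eJ eK =
  scons a (sone b) (eq_refl (pnil A)) (eq_refl (pnil C))
    :> strip_in K (pnil A) (pnil C) f h.
Proof.
by rewrite (proof_irrelevance _ eJ eq_refl) (proof_irrelevance _ eK eq_refl).
Qed.

Lemma vassoc1 (A C E G : ob K) (f g : ver A C) (h k : ver C E) (u v : ver E G)
    (a : vcell f g) (b : vcell h k) (c : vcell u v)
    p q (ep : vcomp h f = p) (eq0 : vcomp k g = q)
    r t (er : vcomp u p = r) (et : vcomp v q = t)
    x y (ex : vcomp u h = x) (ey : vcomp v k = y)
    (er' : vcomp x f = r) (et' : vcomp y g = t) :
  comp (sone (comp (sone a) b ep eq0)) c er et =
  comp (sone a) (comp (sone b) c ex ey) er' et'.
Proof. by subst p q x y; apply: (comp_assoc (one2 (sone a) b)). Qed.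

Definition vpair (A C : ob K) (f g h : ver A C)
    (a : vcell f g) (b : vcell g h) :
    strip_in K (pnil A) (pnil C) f h := scons a (sone b) eq_refl eq_refl.

Lemma vassoc_out (A C E G : ob K) (f g h : ver A C) (x y : ver C E)
    (u v : ver E G) (a : vcell f g) (b : vcell g h) (c : vcell x y)
    (d : vcell u v) p q (ep : vcomp x f = p) (eq0 : vcomp y h = q)
    r t (er : vcomp u p = r) (et : vcomp v q = t)
    m n (em : vcomp u x = m) (en : vcomp v y = n)
    (er' : vcomp m f = r) (et' : vcomp n h = t) :
  comp (sone (comp (vpair a b) c ep eq0)) d er et =
  comp (vpair a b) (comp (sone c) d em en) er' et'.
Proof. by subst p q m n; apply: (comp_assoc (one2 (vpair a b) c)). Qed.

Lemma vassoc2 (A C E G : ob K) (f g h : ver A C) (x y z : ver C E)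
    (u v : ver E G) (a : vcell f g) (a' : vcell g h)
    (b : vcell x y) (b' : vcell y z) (c : vcell u v)
    p q o (ep : vcomp x f = p) (eq0 eq2 : vcomp y g = q) (eo : vcomp z h = o)
    r t (er : vcomp u p = r) (et : vcomp v o = t)
    m n (em : vcomp u x = m) (en : vcomp v z = n)
    (er' : vcomp m f = r) (et' : vcomp n h = t) :
  comp (vpair (comp (sone a) b ep eq0) (comp (sone a') b' eq2 eo)) c er et =
  comp (vpair a a') (comp (vpair b b') c em en) er' et'.
Proof.
subst p q o m n; rewrite (proof_irrelevance _ eq2 eq_refl).
exact: (comp_assoc (@cons2 K _ _ _ _ _ _ _ _ _ _ _ _ _ _ _ _ (sone a) b
          _ _ _ _ _ (one2 (sone a') b') (pnil A) (pnil C) (pnil E)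
          eq_refl eq_refl eq_refl)).
Qed.

Lemma vunit_l (A C : ob K) (f g : ver A C) (a : vcell f g) e e' :
  comp (sone a) (idv (vid C)) e e' = a.
Proof. exact: (comp_idl a). Qed.

Lemma vins_l (A C E : ob K) (f g : ver A C) (h k : ver C E) (a : vcell f g)
    (b : vcell h k) p q (ep : vcomp h f = p) (eq0 : vcomp k g = q) :
  comp (vpair (idv f) a) b ep eq0 = comp (sone a) b ep eq0.
Proof. exact: (comp_insert_first (sone a)). Qed.

Lemma vins_r (A C E : ob K) (f g : ver A C) (h k : ver C E) (a : vcell f g)
    (b : vcell h k) p q (ep : vcomp h f = p) (eq0 : vcomp k g = q) :
  comp (vpair a (idv g)) b ep eq0 = comp (sone a) b ep eq0.
Proof.
rewrite -(comp_insert_last (sone a) b ep eq0) /=.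
by apply: comp_irr => //; rewrite scons_irr.
Qed.

Lemma vcell_compE (A C : ob K) (f g h : ver A C)
    (a : vcell f g) (b : vcell g h) :
  vcell_comp a b =
  comp (vpair a b) (idv (vid C)) (vcomp_idl f) (vcomp_idl h).
Proof. by []. Qed.

Lemma vcell_comp_idl (A C : ob K) (f g : ver A C) (a : vcell f g) :
  vcell_comp (idv f) a = a.
Proof. by rewrite vcell_compE vins_l vunit_l. Qed.

Lemma vcell_comp_idr (A C : ob K) (f g : ver A C) (a : vcell f g) :
  vcell_comp a (idv g) = a.
Proof. by rewrite vcell_compE vins_r vunit_l. Qed.

Lemma vcell_comp_assoc (A C : ob K) (f g h k : ver A C)
    (a : vcell f g) (b : vcell g h) (c : vcell h k) :
  vcell_comp a (vcell_comp b c) = vcell_comp (vcell_comp a b) c.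
Proof.
have H1 (p q r : ver A C) (ep : vcomp (vid C) f = p)
    (eq0 eq0' : vcomp (vid C) g = q) (er : vcomp (vid C) k = r)
    (ep' : vcomp (vid C) p = f) (er' : vcomp (vid C) r = k) ef ek :
  comp (vpair (comp (sone a) (idv (vid C)) ep eq0)
          (comp (vpair b c) (idv (vid C)) eq0' er)) (idv (vid C)) ep' er' =
  comp (scons a (vpair b c) (eq_refl (pnil A)) (eq_refl (pnil C)))
    (comp (vpair (idv (vid C)) (idv (vid C))) (idv (vid C)) eq_refl eq_refl)
    ef ek.
  subst p q r; rewrite (proof_irrelevance _ eq0' eq_refl).
  exact: (comp_assoc (@cons2 K _ _ _ _ _ _ _ _ _ _ _ _ _ _ _ _
            (sone a) (idv (vid C)) _ _ _ _ _
            (one2 (vpair b c) (idv (vid C))) (pnil A) (pnil C) (pnil C)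
            eq_refl eq_refl eq_refl)).
have H2 (p q r : ver A C) (ep : vcomp (vid C) f = p)
    (eq0 eq0' : vcomp (vid C) h = q) (er : vcomp (vid C) k = r)
    (ep' : vcomp (vid C) p = f) (er' : vcomp (vid C) r = k) ef ek :
  comp (vpair (comp (vpair a b) (idv (vid C)) ep eq0)
          (comp (sone c) (idv (vid C)) eq0' er)) (idv (vid C)) ep' er' =
  comp (scons a (vpair b c) (eq_refl (pnil A)) (eq_refl (pnil C)))
    (comp (vpair (idv (vid C)) (idv (vid C))) (idv (vid C)) eq_refl eq_refl)
    ef ek.
  subst p q r; rewrite (proof_irrelevance _ eq0' eq_refl).
  transitivity (comp (sapp (vpair a b) (sone c) (eq_refl (pnil A))
      (eq_refl (pnil C)))
    (comp (vpair (idv (vid C)) (idv (vid C))) (idv (vid C)) eq_refl eq_refl)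
    ef ek).
    exact: (comp_assoc (@cons2 K _ _ _ _ _ _ _ _ _ _ _ _ _ _ _ _
              (vpair a b) (idv (vid C)) _ _ _ _ _
              (one2 (sone c) (idv (vid C))) (pnil A) (pnil C) (pnil C)
              eq_refl eq_refl eq_refl)).
  apply: comp_irr => //=.
  by congr scons; exact: proof_irrelevance.
have ef : vcomp (vcomp (vid C) (vid C)) f = f by rewrite !vcomp_idl.
have ek : vcomp (vcomp (vid C) (vid C)) k = k by rewrite !vcomp_idl.
rewrite !vcell_compE.
rewrite -{1}(vunit_l a (vcomp_idl f) (vcomp_idl g)).
rewrite -{2}(vunit_l c (vcomp_idl h) (vcomp_idl k)).
by rewrite (H1 _ _ _ _ _ _ _ _ _ ef ek) (H2 _ _ _ _ _ _ _ _ _ ef ek).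
Qed.

Definition wlV (A B C : ob K) (h : ver B C) (f g : ver A B) (a : vcell f g) :
    vcell (vcomp h f) (vcomp h g) := post a eq_refl eq_refl.

Definition wrV (A B C : ob K) (g h : ver B C) (a : vcell g h) (f : ver A B) :
    vcell (vcomp g f) (vcomp h f) := pre a eq_refl eq_refl.

Lemma wl_V (A B C : ob K) (k : ver B C) (f g h : ver A B)
    (a : vcell f g) (b : vcell g h) :
  wlV k (vcell_comp a b) = vcell_comp (wlV k a) (wlV k b).
Proof.
have e1 : vcomp (vid C) k = k by exact: vcomp_idl.
have e2 : vcomp k (vid B) = k by exact: vcomp_idr.
rewrite /wlV /post !vcell_compE.
rewrite (vassoc_out _ _ _ _ _ _ _ _ e2 e2 eq_refl eq_refl).
rewrite (vassoc2 _ _ _ _ _ _ _ _ _ _ _ e1 e1 eq_refl eq_refl).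
by rewrite vins_l !vunit_l; apply: comp_irr => //; exact: comp_idr_nil.
Qed.

Lemma wr_V (A B C : ob K) (f g h : ver B C)
    (a : vcell f g) (b : vcell g h) (k : ver A B) :
  wrV (vcell_comp a b) k = vcell_comp (wrV a k) (wrV b k).
Proof.
rewrite /wrV /pre !vcell_compE.
by rewrite (vassoc2 _ _ _ _ _ _ _ _ _ _ _ (vcomp_idl f) (vcomp_idl h)
  eq_refl eq_refl) vins_l.
Qed.

Lemma vcastE (A B C : ob K) (f g : ver A B) (h k : ver B C)
    (a : vcell f g) (b : vcell h k) p q p' q'
    (ep : vcomp h f = p) (eq0 : vcomp k g = q) (ep' : p = p') (eq0' : q = q')
    er et :
  cast2 (R := @vcell K A C) ep' eq0' (comp (sone a) b ep eq0) =
  comp (sone a) b er et.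
Proof. by subst p' q'; exact: comp_irr. Qed.

Lemma interchangeV (A B C : ob K) (f f' : ver A B) (g g' : ver B C)
    (a : vcell f f') (b : vcell g g') :
  vcell_comp (wlV g a) (wrV b f') = vcell_comp (wrV b f) (wlV g' a).
Proof.
rewrite /wrV /wlV /pre /post !vcell_compE.
rewrite !(vassoc2 _ _ _ _ _ _ _ _ _ _ _ (vcomp_idl g) (vcomp_idl g')
  eq_refl eq_refl).
by rewrite !vins_l !vins_r.
Qed.

Lemma wl_id1V (A B : ob K) (f g : ver A B) (a : vcell f g) :
  cast2 (vcomp_idl f) (vcomp_idl g) (wlV (vid B) a) = a.
Proof. by rewrite (vcastE _ _ _ _ _ _ (vcomp_idl f) (vcomp_idl g)) vunit_l. Qed.

Lemma wr_id1V (A B : ob K) (f g : ver A B) (a : vcell f g) :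
  cast2 (vcomp_idr f) (vcomp_idr g) (wrV a (vid A)) = a.
Proof.
rewrite (vcastE _ _ _ _ _ _ (vcomp_idr f) (vcomp_idr g)); exact: comp_idr_nil.
Qed.

Lemma wl_c1V (A B C D : ob K) (k : ver C D) (h : ver B C) (f g : ver A B)
    (a : vcell f g) :
  cast2 (vcomp_assoc k h f) (vcomp_assoc k h g) (wlV k (wlV h a)) =
  wlV (vcomp k h) a.
Proof.
rewrite /wlV /post.
rewrite (vcastE _ _ _ _ _ _ (vcomp_assoc k h f) (vcomp_assoc k h g)).
by rewrite (vassoc1 _ _ _ _ _ _ _ eq_refl eq_refl eq_refl eq_refl) idv_comp.
Qed.

Lemma wr_c1V (A B C D : ob K) (f g : ver C D) (a : vcell f g)
    (h : ver B C) (k : ver A B) :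
  cast2 (vcomp_assoc f h k) (vcomp_assoc g h k) (wrV a (vcomp h k)) =
  wrV (wrV a h) k.
Proof.
rewrite /wrV /pre.
rewrite (vcastE _ _ _ _ _ _ (vcomp_assoc f h k) (vcomp_assoc g h k)).
by rewrite -idv_comp; exact: vassoc1.
Qed.

Lemma wl_wrV (A B C D : ob K) (h : ver C D) (f g : ver B C)
    (a : vcell f g) (k : ver A B) :
  cast2 (vcomp_assoc h f k) (vcomp_assoc h g k) (wlV h (wrV a k)) =
  wrV (wlV h a) k.
Proof.
rewrite /wrV /pre /wlV /post.
rewrite (vcastE _ _ _ _ _ _ (vcomp_assoc h f k) (vcomp_assoc h g k)).
exact: vassoc1.
Qed.

Definition vertical_twocat : twocat :=
  @Build_twocat (ob K) (@ver K) (@vid K) (@vcomp K) (@vcell K)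
    (@idv K) (@vcell_comp K) wlV wrV
    (@vcomp_idl K) (@vcomp_idr K) (@vcomp_assoc K)
    vcell_comp_idl vcell_comp_idr vcell_comp_assoc
    (fun A B C h f => idv_comp h f) wl_V (fun A B C h f => idv_comp h f) wr_V
    wl_id1V wr_id1V wl_c1V wr_c1V wl_wrV interchangeV.

End Vertical.

(* Main.v *)
(* Write R for the restriction j_*(id, f), c : R => j_* for its cartesian cell
   and pi for the tabulation of R. Since cart o c : R => B is cartesian,
   (cart o c) o pi exhibits the tabulation of R as the comma object j/f, and
   Street's pasted 2-cell is (eta' o c) o pi. As pi is weakly cocartesian,
   Street's condition says precisely that eta' o c has the universal property
   of a left Kan extension with respect to the empty path H. For
   H = (H_1, ..., H_m) nonempty, composing with the cocartesian cell sigma of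
   the tabulation of H_1, extended by the cartesian cells of
   R(id, s) => R and H_2(t, id) => H_2 on either side, replaces H by
   (H_2(t, id), H_3, ..., H_m) and f by f o s, so that the general case follows
   by induction on m. *)

From Stdlib Require Import ssreflect ProofIrrelevance.
Require Import Defs.

Set Implicit Arguments.
Unset Strict Implicit.
Unset Printing Implicit Defensive.

Section AugmentedVirtualDoubleCategory.
Variable K : avdc.

Notation hpath := (path (@hor K)).
Notation htpath := (tpath (@hor K)).

(** * Associativity and unit laws with named boundaries *)

Lemma comp_comp (A B C D E F G H : ob K) (J : hpath A B) (N : hpath C D)
    (L : htpath E F) (R : htpath G H) (f : ver A C) (g : ver B D)
    (h : ver C E) (k : ver D F) (u : ver E G) (v : ver F H)
    (s : strip_in K J N f g) (psi : cell N L h k) (chi : cell (tp L) R u v)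
    p q (ep : vcomp h f = p) (eq0 : vcomp k g = q)
    r t (er : vcomp u p = r) (et : vcomp v q = t)
    m n (em : vcomp u h = m) (en : vcomp v k = n)
    (er' : vcomp m f = r) (et' : vcomp n g = t) :
  comp (sone (comp s psi ep eq0)) chi er et =
  comp s (comp (sone psi) chi em en) er' et'.
Proof. by subst p q m n; exact: (comp_assoc (one2 s psi)). Qed.

(** The associativity axiom for two adjacent columns. As in [comp_comp], all boundary equations are
    variables, so that rewriting works with whatever proofs a goal contains. *)
Lemma comp_scons_comp (A B B' C D D' E F F' G H : ob K)
    (J : hpath A B) (N : hpath C D) (L : htpath E F)
    (J' : hpath B B') (N' : hpath D D') (L' : htpath F F')
    (J2 : hpath A B') (N2 : hpath C D') (L2 : hpath E F') (R : htpath G H)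
    (f : ver A C) (g : ver B D) (g' : ver B' D')
    (h : ver C E) (k : ver D F) (k' : ver D' F') (u : ver E G) (v : ver F' H)
    (s : strip_in K J N f g) (s' : strip_in K J' N' g g')
    (phi : cell N L h k) (psi : cell N' L' k k') (chi : cell L2 R u v)
    (eJ : papp J J' = J2) (eN : papp N N' = N2) (eL : papp (tp L) (tp L') = L2)
    p q o (ep : vcomp h f = p) (eq0 eq1 : vcomp k g = q) (eo : vcomp k' g' = o)
    r t (er : vcomp u p = r) (et : vcomp v o = t)
    m n (em : vcomp u h = m) (en : vcomp v k' = n)
    (er' : vcomp m f = r) (et' : vcomp n g' = t) :
  comp (scons (comp s phi ep eq0) (sone (comp s' psi eq1 eo)) eJ eL) chi er et =
  comp (sapp s s' eJ eN)
    (comp (scons phi (sone psi) eN eL) chi em en) er' et'.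
Proof.
subst p q o m n; rewrite (proof_irrelevance _ eq1 eq_refl).
exact: (comp_assoc (@cons2 K _ _ _ _ _ _ _ _ _ _ _ _ _ _ _ _ s phi
          _ _ _ _ _ (one2 s' psi) J2 N2 L2 eJ eN eL)).
Qed.

(** The interchange law: [hcomp] is a composite with [tid R], so this is associativity with [tid R]
    at the bottom. *)
Lemma hcomp_comp (A B B' C D D' E F F' : ob K)
    (J : hpath A B) (N : hpath C D) (L : htpath E F)
    (J' : hpath B B') (N' : hpath D D') (L' : htpath F F')
    (J2 : hpath A B') (N2 : hpath C D') (R : htpath E F')
    (f : ver A C) (g : ver B D) (g' : ver B' D')
    (h : ver C E) (k : ver D F) (k' : ver D' F')
    (s : strip_in K J N f g) (s' : strip_in K J' N' g g')
    (phi : cell N L h k) (psi : cell N' L' k k')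
    (eJ : papp J J' = J2) (eN : papp N N' = N2)
    (eL : papp (tp L) (tp L') = tp R)
    p q o (ep : vcomp h f = p) (eq0 eq1 : vcomp k g = q)
    (eo : vcomp k' g' = o) :
  hcomp (comp s phi ep eq0) (comp s' psi eq1 eo) eJ eL =
  comp (sapp s s' eJ eN) (hcomp phi psi eN eL) ep eo.
Proof. exact: comp_scons_comp. Qed.

Lemma comp_tid (C D E F : ob K) (R : htpath C D) (L : htpath E F)
    (h : ver C E) (k : ver D F) (chi : cell (tp R) L h k) eh ek :
  comp (sone (tid R)) chi eh ek = chi.
Proof.
case: R h k chi eh ek => [X|X Y N] h k chi eh ek; first exact: comp_idr_nil.
exact: (comp_idr_cons (P := pnil _) chi).
Qed.

(** Associativity moves the identity cell hidden in [hcomp] onto [chi], which absorbs it. *)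
Lemma comp_hcomp (A B B' C D D' E F : ob K)
    (J : hpath A B) (N : htpath C D) (J' : hpath B B') (N' : htpath D D')
    (J2 : hpath A B') (R : htpath C D') (L : htpath E F)
    (f : ver A C) (g : ver B D) (g' : ver B' D') (h : ver C E) (k : ver D' F)
    (phi : cell J N f g) (psi : cell J' N' g g') (chi : cell (tp R) L h k)
    (eJ : papp J J' = J2) (eN : papp (tp N) (tp N') = tp R)
    p q (ep : vcomp h f = p) (eq0 : vcomp k g' = q) :
  comp (sone (hcomp phi psi eJ eN)) chi ep eq0 =
  comp (scons phi (sone psi) eJ eN) chi ep eq0.
Proof.
rewrite /hcomp.
rewrite (comp_comp _ _ _ _ _ _ _ (vcomp_idr h) (vcomp_idr k) ep eq0).
by apply: comp_irr => //; exact: comp_tid.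
Qed.

Lemma hcomp_idv_l (A B C D : ob K) (J : hpath A B) (N : htpath C D)
    (f : ver A C) (g : ver B D) (phi : cell J N f g) :
  hcomp (idv f) phi (P := J) (R := N) eq_refl eq_refl = phi.
Proof. by rewrite /hcomp comp_insert_first comp_idl. Qed.

Lemma hcomp_idv_r (A B C D : ob K) (J : hpath A B) (N : htpath C D)
    (f : ver A C) (g : ver B D) (phi : cell J N f g)
    (eJ : papp J (pnil B) = J) (eN : papp (tp N) (pnil D) = tp N) :
  hcomp phi (idv g) eJ eN = phi.
Proof.
rewrite /hcomp -[RHS](comp_idl phi (vcomp_idl f) (vcomp_idl g)).
rewrite -(comp_insert_last (sone phi)) /=.
apply: comp_irr => //.
by congr scons; exact: proof_irrelevance.
Qed.

Lemma idv_vcomp (A B C : ob K) (h : ver B C) (f : ver A B) p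
    (ep ep' : vcomp h f = p) :
  comp (sone (idv f)) (idv h) ep ep' = idv p.
Proof. by subst p; rewrite -idv_comp; exact: comp_irr. Qed.

Lemma pre_vid (A C D : ob K) (N : htpath C D) (f : ver A C) (g : ver A D)
    (phi : cell (pnil A) N f g) e e' : pre phi (f := vid A) e e' = phi.
Proof. exact: comp_idr_nil. Qed.

Lemma pre_pre (A X Y C D : ob K) (N : htpath C D) (f : ver A C) (g : ver A D)
    (phi : cell (pnil A) N f g) (u : ver X A) (v : ver Y X)
    p q (ep : vcomp f u = p) (eq0 : vcomp g u = q)
    r t (er : vcomp p v = r) (et : vcomp q v = t)
    (w : ver Y A) (ew : vcomp u v = w) er' et' :
  pre (pre phi ep eq0) er et = pre phi (f := w) er' et'.
Proof.
subst w; rewrite /pre -idv_comp.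
by symmetry; exact: comp_comp.
Qed.

(** * Cancellation and factorisation for cartesian and weakly cocartesian cells *)

Section Cartesian.
Variables (A B C D : ob K) (J : htpath A B) (N : htpath C D).
Variables (f : ver A C) (g : ver B D) (psi : cell (tp J) N f g).

Lemma cartesianE (A' B' : ob K) (H : hpath A' B') (h : ver A' A) (k : ver B' B)
    p q (ep : vcomp f h = p) (eq0 : vcomp g k = q) (chi : cell H N p q) :
  cartesian psi -> exists! phi : cell H J h k, chi = comp (sone phi) psi ep eq0.
Proof. by subst p q => psi_cart; exact: psi_cart. Qed.

Lemma cartesian_inj (A' B' : ob K) (H : hpath A' B')
    (h : ver A' A) (k : ver B' B) p q (ep : vcomp f h = p)
    (eq0 : vcomp g k = q) (phi phi' : cell H J h k) :
  cartesian psi ->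
  comp (sone phi) psi ep eq0 = comp (sone phi') psi ep eq0 -> phi = phi'.
Proof.
move=> psi_cart e.
have [x [_ x_uniq]] := cartesianE ep eq0 (comp (sone phi) psi ep eq0) psi_cart.
by rewrite -(x_uniq _ e) (x_uniq phi).
Qed.

Lemma cartesian_comp (A' B' : ob K) (J' : htpath A' B')
    (f' : ver A' A) (g' : ver B' B) (phi : cell (tp J') J f' g')
    p q (ep : vcomp f f' = p) (eq0 : vcomp g g' = q) :
  cartesian psi -> cartesian phi -> cartesian (comp (sone phi) psi ep eq0).
Proof.
move=> psi_cart phi_cart X Y H h k chi.
have e1 : vcomp f (vcomp f' h) = vcomp p h by rewrite vcomp_assoc ep.
have e2 : vcomp g (vcomp g' k) = vcomp q k by rewrite vcomp_assoc eq0.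
have [x [-> x_uniq]] := cartesianE e1 e2 chi psi_cart.
have [y [y_eq y_uniq]] := phi_cart _ _ _ _ _ x.
exists y; split=> [|z].
  by rewrite y_eq; exact: comp_comp.
rewrite -(comp_comp _ _ _ eq_refl eq_refl e1 e2) => z_eq.
by apply: y_uniq; exact: (cartesian_inj psi_cart z_eq).
Qed.

End Cartesian.

Section WeaklyCocartesian.
Variables (A B C D : ob K) (J : hpath A B) (N : hpath C D).
Variables (f : ver A C) (g : ver B D) (s : strip_in K J N f g).
Hypothesis s_cocart : weakly_cocartesian s.

Lemma weakly_cocartesianE (E F : ob K) (L : htpath E F)
    (h : ver C E) (k : ver D F) p q (ep : vcomp h f = p) (eq0 : vcomp k g = q)
    (psi : cell J L p q) :
  exists! psi' : cell N L h k, psi = comp s psi' ep eq0.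
Proof. by subst p q; exact: (proj2 s_cocart). Qed.

Lemma weakly_cocartesian_inj (E F : ob K) (L : htpath E F)
    (h : ver C E) (k : ver D F) p q (ep : vcomp h f = p) (eq0 : vcomp k g = q)
    (psi psi' : cell N L h k) :
  comp s psi ep eq0 = comp s psi' ep eq0 -> psi = psi'.
Proof.
move=> e; have [x [_ x_uniq]] := weakly_cocartesianE ep eq0 (comp s psi ep eq0).
by rewrite -(x_uniq _ e) (x_uniq psi).
Qed.

End WeaklyCocartesian.

(** * Tabulations of restrictions as comma objects *)

(** The one-dimensional half of a tabulation, which already determines [T] up to isomorphism. *)
Definition classifying (A B : ob K) (J : hor A B) (T : ob K)
    (piA : ver T A) (piB : ver T B) (pi : cell (pnil T) (tone J) piA piB) :=
  forall (X : ob K) (phiA : ver X A) (phiB : ver X B)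
    (phi : cell (pnil X) (tone J) phiA phiB),
  exists! u : ver X T,
    exists (eA : vcomp piA u = phiA) (eB : vcomp piB u = phiB),
      phi = pre pi eA eB.

(** Both [u] and the identity factor [pi] through itself. *)
Lemma classifying_endo (A B : ob K) (J : hor A B) (T : ob K)
    (piA : ver T A) (piB : ver T B) (pi : cell (pnil T) (tone J) piA piB)
    (u : ver T T) (eA : vcomp piA u = piA) (eB : vcomp piB u = piB) :
  classifying pi -> pi = pre pi eA eB -> u = vid T.
Proof.
move=> pi_univ e; have [w [_ w_uniq]] := pi_univ _ _ _ pi.
transitivity w; first by symmetry; apply: w_uniq; exists eA, eB.
apply: w_uniq; exists (vcomp_idr piA), (vcomp_idr piB).
by rewrite pre_vid.
Qed.

(* Any two classifying cells differ by precomposition with an isomorphism. *)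
Lemma classifying_weakly_cocartesian (A B : ob K) (J : hor A B) (T P : ob K)
    (piA : ver T A) (piB : ver T B) (pi : cell (pnil T) (tone J) piA piB)
    (p : ver P A) (q : ver P B) (pi' : cell (pnil P) (tone J) p q) :
  classifying pi -> classifying pi' ->
  weakly_cocartesian (sone pi) -> weakly_cocartesian (sone pi').
Proof.
move=> pi_univ pi'_univ pi_cocart; split=> // E F L h k psi.
have [u [[uA [uB u_eq]] _]] := pi_univ _ _ _ pi'.
have [v [[vA [vB v_eq]] _]] := pi'_univ _ _ _ pi.
have vu : vcomp v u = vid P.
  have eA : vcomp p (vcomp v u) = p by rewrite vcomp_assoc vA.
  have eB : vcomp q (vcomp v u) = q by rewrite vcomp_assoc vB.
  apply: (classifying_endo (eA := eA) (eB := eB) pi'_univ).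
  by rewrite -(pre_pre _ vA vB uA uB eq_refl) -v_eq.
have hv : vcomp (vcomp h p) v = vcomp h piA by rewrite -vcomp_assoc vA.
have kv : vcomp (vcomp k q) v = vcomp k piB by rewrite -vcomp_assoc vB.
have hu : vcomp (vcomp h piA) u = vcomp h p by rewrite -vcomp_assoc uA.
have ku : vcomp (vcomp k piB) u = vcomp k q by rewrite -vcomp_assoc uB.
(* Precomposing [psi] with [v] gives a cell over [T], which factors through [pi]; precomposing with
   [u] then recovers [psi], by [vu]. *)
have [x [x_eq x_uniq]] := weakly_cocartesianE pi_cocart eq_refl eq_refl
  (comp (sone (idv v)) psi hv kv).
exists x; split=> [|y y_eq].
  have e1 : vcomp (vcomp h p) (vid P) = vcomp h p by exact: vcomp_idr.
  have e2 : vcomp (vcomp k q) (vid P) = vcomp k q by exact: vcomp_idr.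
  rewrite u_eq /pre (comp_comp _ _ _ _ _ eq_refl eq_refl eq_refl eq_refl hu ku).
  rewrite -x_eq -(comp_comp _ _ _ vu vu e1 e2) (idv_vcomp vu vu).
  by rewrite comp_idr_nil.
apply: x_uniq; rewrite y_eq v_eq /pre.
by symmetry; exact: comp_comp.
Qed.

(** Whiskering with [u] affects only the upper factor [pi]. This translates the cast equation of
    [is_comma] into one between cells with target [R]. *)
Lemma wr_restriction_comp (A B D P X : ob K) (j : ver A B) (f : ver D B)
    (R : hor A D) (kappa : cell (pone R) (tnil B) j f)
    (p : ver P A) (q : ver P D) (pi : cell (pnil P) (tone R) p q)
    (u : ver X P) (a : ver X A) (b : ver X D)
    (ea : vcomp p u = a) (eb : vcomp q u = b) :
  cast2 (R := @vcell K X B)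
    (@c1_assoc_eq (vertical_twocat K) _ _ _ _ j _ _ _ ea)
    (@c1_assoc_eq (vertical_twocat K) _ _ _ _ f _ _ _ eb)
    (wrV (comp (sone pi) kappa eq_refl eq_refl) u) =
  comp (sone (pre pi ea eb)) kappa eq_refl eq_refl.
Proof.
have e1 : vcomp (vcomp j p) u = vcomp j a by rewrite -vcomp_assoc ea.
have e2 : vcomp (vcomp f q) u = vcomp f b by rewrite -vcomp_assoc eb.
rewrite /wrV /pre (vcastE _ _ _ _ _ _ e1 e2).
by symmetry; exact: comp_comp.
Qed.

(** As [kappa] is cartesian, 2-cells from [j a] to [f b] correspond to cells from the empty path to
    [R], and these to vertical morphisms into [T]. *)
Lemma tabulation_comma (A B D T : ob K) (j : ver A B) (f : ver D B)
    (R : hor A D) (kappa : cell (pone R) (tnil B) j f)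
    (piA : ver T A) (piD : ver T D) (pi : cell (pnil T) (tone R) piA piD) :
  is_restriction kappa -> is_tabulation pi ->
  @is_comma (vertical_twocat K) A B D j f T piA piD
    (comp (sone pi) kappa eq_refl eq_refl).
Proof.
move=> kappa_cart [pi_univ1 pi_univ2]; split.
  move=> X a b mu.
  have [phi [mu_eq _]] := kappa_cart _ _ _ _ _ mu.
  have [u [[eA [eB phi_eq]] u_uniq]] := pi_univ1 _ _ _ phi.
  exists u; split.
    by exists eA, eB; rewrite mu_eq phi_eq; exact: wr_restriction_comp.
  move=> v [vA [vB v_eq]]; apply: u_uniq; exists vA, vB.
  apply: (cartesian_inj kappa_cart (ep := eq_refl) (eq0 := eq_refl)).
  by rewrite -mu_eq -wr_restriction_comp; symmetry; exact: v_eq.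
move=> X u v a b /= ab.
have [|c [[cA cB] c_uniq]] := pi_univ2 _ _ _ _ (pre pi eq_refl eq_refl) _ _
  (pre pi eq_refl eq_refl) u eq_refl eq_refl v eq_refl eq_refl (pnil X) a b
  eq_refl eq_refl.
  (* The compatibility condition of the tabulation can be checked after composition with [kappa],
     where it becomes the comma equation [ab]. *)
  apply: (cartesian_inj kappa_cart (ep := vcomp_assoc j piA u)
    (eq0 := vcomp_assoc f piD v)).
  rewrite !comp_hcomp; symmetry.
  have lam_w (w : ver X T) : wrV (comp (sone pi) kappa eq_refl eq_refl) w =
      comp (sone (pre pi (f := w) eq_refl eq_refl)) kappa
        (vcomp_assoc j piA w) (vcomp_assoc f piD w).
    by symmetry; exact: comp_comp.
  move: ab; rewrite /wlV /post !lam_w.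
  rewrite (vcastE _ _ _ _ _ _ (vcomp_assoc f piD u) (vcomp_assoc f piD v)).
  rewrite (vcastE _ _ _ _ _ _ (vcomp_assoc j piA u) (vcomp_assoc j piA v)).
  rewrite /vcell_comp.
  rewrite (hcomp_comp _ _ _ _ (eq_refl : papp (pnil X) (pnil X) = pnil X)
     (eq_refl : papp (pone R) (pnil D) = pone R)).
  rewrite (hcomp_comp _ _ _ _ (eq_refl : papp (pnil X) (pnil X) = pnil X)
     (eq_refl : papp (pnil A) (pone R) = pone R)).
  rewrite hcomp_idv_r hcomp_idv_l /= => ab'.
  rewrite ab'; apply: comp_irr => //.
  by congr scons; exact: proof_irrelevance.
exists c; split; first by split.
by move=> c' [cA' cB']; apply: c_uniq.
Qed.

(** Cancelling [kappa] transfers the one-dimensional property from the comma object to [pi]. It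
    serves to reach arbitrary comma objects, since Street's condition quantifies over all of
    them. *)
Lemma comma_classifying (A B D P : ob K) (j : ver A B) (f : ver D B)
    (R : hor A D) (kappa : cell (pone R) (tnil B) j f)
    (p : ver P A) (q : ver P D) (pi : cell (pnil P) (tone R) p q) :
  is_restriction kappa ->
  @is_comma (vertical_twocat K) A B D j f P p q
    (comp (sone pi) kappa eq_refl eq_refl) ->
  classifying pi.
Proof.
move=> kappa_cart [comma1 _] X a b phi.
have [u [[ea [eb u_eq]] u_uniq]] :=
  comma1 X a b (comp (sone phi) kappa eq_refl eq_refl).
exists u; split.
  exists ea, eb.
  apply: (cartesian_inj kappa_cart (ep := eq_refl) (eq0 := eq_refl)).
  by rewrite -wr_restriction_comp; symmetry; exact: u_eq.
move=> v [va [vb v_eq]]; apply: u_uniq; exists va, vb.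
by rewrite v_eq; exact: wr_restriction_comp.
Qed.

(** * Street's condition and the empty path *)

(** Once [eta'] is moved to the bottom, [cocart] and [cart] stand side by side and cancel by the
    horizontal companion identity. *)
Lemma comma_pasting_companion (A B M D P : ob K) (d : ver A M) (j : ver A B)
    (l : ver B M) (f : ver D B) (jstar : hor A B) (R : hor A D)
    (cart : cell (pone jstar) (tnil B) j (vid B))
    (cocart : cell (pnil A) (tone jstar) (vid A) j)
    (eta' : cell (pone jstar) (tnil M) d l)
    (c : cell (pone R) (tone jstar) (vid A) f)
    (p : ver P A) (q : ver P D) (pi : cell (pnil P) (tone R) p q) :
  is_companion cart cocart ->
  @comma_pasting (vertical_twocat K) A B M D P d j l
    (comp (sone cocart) eta' (vcomp_idr d) (eq_refl (vcomp l j))) f p q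
    (comp (sone pi) (comp (sone c) cart (vcomp_idr j) (vcomp_idl f))
       eq_refl eq_refl) =
  comp (sone pi) (comp (sone c) eta' (vcomp_idr d) (eq_refl (vcomp l f)))
    eq_refl eq_refl.
Proof.
move=> companion; rewrite /comma_pasting /= /wrV /wlV /pre /post.
rewrite (vcastE _ _ _ _ _ _ (vcomp_assoc l j p) (vcomp_assoc l f q)).
rewrite -(comp_comp (sone (idv p)) cocart eta' (vcomp_idl p)
  (eq_refl (vcomp j p)) eq_refl (vcomp_assoc l j p)).
rewrite /vcell_comp.
rewrite (hcomp_comp _ _ _ _ (eq_refl : papp (pnil P) (pnil P) = pnil P)
   (eq_refl : papp (pone jstar) (pnil B) = pone jstar)).
rewrite hcomp_idv_r /=.
rewrite -(comp_hcomp (N := tone jstar) (N' := tnil B) (R := tone jstar)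
  _ _ eta').
rewrite -(comp_comp (sone pi) c eta' (vcomp_idl p) (eq_refl (vcomp f q))
  eq_refl (vcomp_assoc l f q)).
(* Both sides now end in [eta']; only the cells above it, with target [jstar], remain to be
   compared. *)
apply: comp_irr => //; congr sone.
rewrite -(comp_comp (sone pi) c cart (vcomp_idl p) (eq_refl (vcomp f q))
  eq_refl (vcomp_idl (vcomp f q))).
rewrite (hcomp_comp _ _ _ _ (eq_refl : papp (pnil P) (pnil P) = pnil P)
   (eq_refl : papp (pnil A) (pone jstar) = pone jstar)).
rewrite (companion_horizontal companion) /= comp_insert_first.
exact: (comp_idl (N := tone jstar)).
Qed.

(** Precomposition with [pi] is a bijection from cells on [R] to vertical cells on [P], and by
    [hcomp_pi] it turns [hcomp theta phi'] into the pasting with [phi'] whiskered by [q]. *)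
Lemma is_lan2_lan_nil (A D M P : ob K) (d : ver A M) (m : ver D M)
    (R : hor A D) (theta : cell (pone R) (tnil M) d m)
    (p : ver P A) (q : ver P D) (pi : cell (pnil P) (tone R) p q) :
  weakly_cocartesian (sone pi) ->
  @is_lan2 (vertical_twocat K) P D M (vcomp d p) q m
    (comp (sone pi) theta eq_refl eq_refl) <->
  forall (k : ver D M) (phi : cell (pone R) (tnil M) d k),
  exists! phi' : vcell m k,
    phi = hcomp theta phi' (H := pnil D) (P := pone R) (R := tnil M)
      eq_refl eq_refl.
Proof.
move=> pi_cocart.
have hcomp_pi (k : ver D M) (phi' : vcell m k) :
    vcell_comp (comp (sone pi) theta eq_refl eq_refl) (wrV phi' q) =
    comp (sone pi) (hcomp theta phi' (H := pnil D) (P := pone R) (R := tnil M)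
      eq_refl eq_refl) eq_refl eq_refl.
  rewrite /wrV /pre /vcell_comp.
  rewrite (hcomp_comp _ _ _ _ (eq_refl : papp (pnil P) (pnil P) = pnil P)
     (eq_refl : papp (pone R) (pnil D) = pone R)).
  rewrite -(comp_insert_last (sone pi)) /=.
  apply: comp_irr => //.
  by congr scons; exact: proof_irrelevance.
split=> [lan k phi|lan k psi].
  have [x [x_eq x_uniq]] := lan k (comp (sone pi) phi eq_refl eq_refl).
  exists x; split=> [|y y_eq].
    apply: (weakly_cocartesian_inj pi_cocart (ep := eq_refl) (eq0 := eq_refl)).
    by rewrite -hcomp_pi.
  by apply: x_uniq; rewrite y_eq -hcomp_pi.
have [phi [psi_eq _]] := weakly_cocartesianE pi_cocart eq_refl eq_refl psi.
have [x [x_eq x_uniq]] := lan k phi.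
exists x; split=> [|y y_eq]; first by rewrite psi_eq x_eq -hcomp_pi.
apply: x_uniq.
apply: (weakly_cocartesian_inj pi_cocart (ep := eq_refl) (eq0 := eq_refl)).
by rewrite -hcomp_pi -psi_eq.
Qed.

(** * Reduction of nonempty paths to the empty one *)

(** The condition of [is_lan] at one fixed path [H], isolated for the induction on paths. *)
Definition lan_at (A B M : ob K) (J : hpath A B) (d : ver A M) (l : ver B M)
    (eta : cell J (tnil M) d l) (B' : ob K) (H : hpath B B') :=
  forall (k : ver B' M) (phi : cell (papp J H) (tnil M) d k),
  exists! phi' : cell H (tnil M) l k,
    phi = hcomp eta phi' (R := tnil M) eq_refl eq_refl.

(** Precompose [phi] with the path ([rho], [s]) and factor the result over [H']. The factor descends
    along [s], and the equation for [phi] follows by cancelling ([rho], [s]). *)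
Lemma lan_at_descent (A D D' M S S' : ob K) (R : hor A D) (R' : hor A S)
    (H : hpath D D') (H' : hpath S S') (d : ver A M) (m : ver D M)
    (x : ver S D) (y : ver S' D') (theta : cell (pone R) (tnil M) d m)
    (rho : cell (pone R') (tone R) (vid A) x) (s : strip_in K H' H x y)
    (n : ver S M) (mx : vcomp m x = n) :
  weakly_cocartesian s ->
  weakly_cocartesian (scons rho s (eq_refl (pcons R' H'))
    (eq_refl (pcons R H))) ->
  lan_at (comp (sone rho) theta (vcomp_idr d) mx) H' ->
  lan_at theta H.
Proof.
move=> s_cocart rs_cocart lan k phi.
set t := scons rho s _ _ in rs_cocart.
have hcomp_t (phi' : cell H (tnil M) m k) :
    comp t (hcomp theta phi' (P := pcons R H) (R := tnil M) eq_refl eq_refl)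
      (vcomp_idr d) (eq_refl (vcomp k y)) =
    hcomp (comp (sone rho) theta (vcomp_idr d) mx)
      (comp s phi' mx eq_refl) (P := pcons R' H') (R := tnil M)
      eq_refl eq_refl.
  by symmetry; exact: (hcomp_comp (sone rho) s).
have [u [u_eq u_uniq]] := lan _ (comp t phi (vcomp_idr d) eq_refl).
have [v [v_eq v_uniq]] := weakly_cocartesianE s_cocart mx eq_refl u.
exists v; split=> [|w w_eq].
  apply: (weakly_cocartesian_inj rs_cocart (ep := vcomp_idr d) (eq0 := eq_refl)).
  by rewrite hcomp_t -v_eq.
by apply: v_uniq; apply: u_uniq; rewrite w_eq hcomp_t.
Qed.

Section Pointwise.
Variables (A B M : ob K) (N : hor A B) (d : ver A M) (l : ver B M).
Variable eta : cell (pone N) (tnil M) d l.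

(** The quantification over [f] lets the induction replace [f] by its composite with a leg of a
    tabulation. *)
Definition pointwise_lan_at (X Y : ob K) (H : hpath X Y) :=
  forall (f : ver X B) (R : hor A X) (c : cell (pone R) (tone N) (vid A) f),
  is_restriction c ->
  lan_at (comp (sone c) eta (vcomp_idr d) (eq_refl (vcomp l f))) H.

(** Restricting [R] further along [sX] gives a restriction of [N] along [vcomp f sX], to which the
    hypothesis on [J'] applies. *)
Lemma pointwise_lan_at_descent (X Y T : ob K) (H1 : hor X Y)
    (sX : ver T X) (sY : ver T Y) (sigma : cell (pnil T) (tone H1) sX sY)
    (T' X' : ob K) (J' : hpath T T') (N' : hpath X X') (g' : ver T' X')
    (s : strip_in K J' N' sX g') :
  cocartesian (sone sigma) -> right_ext (sone sigma) s ->
  pointwise_lan_at J' -> pointwise_lan_at N'.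
Proof.
move=> [_ [restr_l [_ ext]]] s_ext lanJ f R c c_cart.
have [R' [rho rho_cart]] := restr_l _ R.
have s_cocart := ext _ _ _ _ _ _ s_ext _ _ _ _ _ _ (left_ext0 s).
(* With [pnil A] no identity cells precede [rho]. *)
have rs_cocart := ext _ _ _ _ _ _ s_ext _ _ _ _ _ _
  (left_ext_cart s (pnil A) rho_cart).
apply: (lan_at_descent (mx := eq_sym (vcomp_assoc l f sX)) s_cocart rs_cocart).
rewrite -(comp_comp (sone rho) c eta (vcomp_idl (vid A))
  (eq_refl (vcomp f sX)) (vcomp_idr d) eq_refl).
by apply: lanJ; exact: cartesian_comp.
Qed.

Lemma pointwise_lan_at_cons :
  augmented_virtual_equipment K -> has_cocartesian_tabulations K ->
  (forall X : ob K, pointwise_lan_at (pnil X)) ->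
  forall (X Y Z : ob K) (H1 : hor X Y) (H : hpath Y Z),
  pointwise_lan_at (pcons H1 H).
Proof.
move=> equipment tabulations lan_nil X Y Z H1 H.
(* The head [H1] is generalised: tabulating it leaves the restriction [R2] of [H2] as the new head,
   over the shorter tail. *)
elim: H X H1 => [W|W Y' Z' H2 H IH] X H1;
  have [T [sX [sY [sigma [_ sigma_cocart]]]]] := tabulations _ _ H1.
  exact: (pointwise_lan_at_descent sigma_cocart (right_ext0 _) (lan_nil T)).
have [R2 [rho rho_cart]] := equipment _ _ _ _ H2 sY (vid Y').
exact: (pointwise_lan_at_descent sigma_cocart
  (right_ext_cart (sone sigma) H rho_cart) (IH T R2)).
Qed.

End Pointwise.

End AugmentedVirtualDoubleCategory.

(** * Comparison of the two pointwise conditions *)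

Theorem proposition4p35 (K : avdc)
    (equipment : augmented_virtual_equipment K)
    (tabulations : has_cocartesian_tabulations K)
    (A B M : ob K) (d : ver A M) (j : ver A B) (l : ver B M)
    (jstar : hor A B)
    (cart : cell (pone jstar) (tnil B) j (vid B))
    (cocart : cell (pnil A) (tone jstar) (vid A) j)
    (companion : is_companion cart cocart)
    (eta : vcell d (vcomp l j))
    (eta' : cell (pone jstar) (tnil M) d l)
    (factorisation :
       eta = comp (sone cocart) eta' (vcomp_idr d) (eq_refl (vcomp l j))) :
  @is_pointwise_lan2 (vertical_twocat K) A B M d j l eta <->
  @is_pointwise_lan K A A B M (pnil A) jstar d l eta'.
Proof.
subst eta.
(* Thus [R] is also the restriction of the empty path at [B] along [j] and [f]. *)
have kappa_cart (D : ob K) (f : ver D B) (R : hor A D)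
    (c : cell (pone R) (tone jstar) (vid A) f) : is_restriction c ->
    is_restriction (comp (sone c) cart (vcomp_idr j) (vcomp_idl f)).
  by move=> c_cart; exact: (cartesian_comp _ _ (companion_cart companion)).
split=> [lan|lan D f].
  (* Street's condition is applied to the comma object given by the tabulation of [R]. *)
  have lan_nil (X : ob K) : pointwise_lan_at eta' (pnil X).
    move=> f R c c_cart.
    have [T [piA [piX [pi [pi_tab [pi_cocart _]]]]]] := tabulations _ _ R.
    have [_ /(_ _ _ _ _ (tabulation_comma (kappa_cart _ _ _ _ c_cart) pi_tab))]
      := lan _ f.
    rewrite comma_pasting_companion //.
    exact: (proj1 (is_lan2_lan_nil _ pi_cocart)).
  move=> X f R c c_cart Y H.
  case: H f R c c_cart => [W|W W' W'' H1 H] f R c c_cart; first exact: lan_nil.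
  exact: pointwise_lan_at_cons.
have [R [c c_cart]] := equipment _ _ _ _ jstar (vid A) f.
have [T [piA [piD [pi [pi_tab [pi_cocart _]]]]]] := tabulations _ _ R.
split.
  exists T, piA, piD, (comp (sone pi)
    (comp (sone c) cart (vcomp_idr j) (vcomp_idl f)) eq_refl eq_refl).
  exact: tabulation_comma (kappa_cart _ _ _ _ c_cart) pi_tab.
move=> P p q lam lam_comma.
(* An arbitrary comma cell [lam] comes from a cell [pi'] into [R]; being classifying like [pi], it
   inherits weak cocartesianness from [pi]. *)
have [pi' [lam_eq _]] := kappa_cart _ _ _ _ c_cart _ _ _ _ _ lam.
rewrite lam_eq in lam_comma *.
rewrite comma_pasting_companion //.
apply: (proj2 (is_lan2_lan_nil _ _)); last first.
  by move=> k phi; exact: (lan _ f R c c_cart D (pnil D) k phi).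
apply: (classifying_weakly_cocartesian (proj1 pi_tab) _ pi_cocart).
exact: comma_classifying (kappa_cart _ _ _ _ c_cart) lam_comma.
Qed.
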